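(* For each even integer $n \ge 6$, there exist a simple binary matroid $M$ of rank $n-1$ with $2n$ elements and a colouring $c$ of $E(M)$ in which each colour class has size exactly $2$, such that every circuit of $M$ whose elements have pairwise distinct colours has size strictly greater than $n/2$.
   Context: A matroid is a finite ground set with a collection of nonempty, inclusion-incomparable subsets called circuits satisfying circuit elimination; its rank is the size of a largest subset containing no circuit. A matroid is simple if it has no circuits of size $1$ or $2$. A matroid is binary if it is isomorphic to the column matroid of a matrix over the two-element field $\mathbb{F}_2$, i.e. the matroid on the columns whose circuits are the inclusion-minimal linearly dependent sets of columns. *)

(* Defs.v *)
From HB Require Import structures.
From mathcomp Require Export all_boot all_order all_algebra.

Set Implicit Arguments.
Unset Strict Implicit.
Unset Printing Implicit Defensive.

Import GRing.Theory.

Record matroid (E : finType) := Matroid {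
  circuits : {set {set E}};
  circuit_neq0 : forall C, C \in circuits -> C != set0;
  circuit_incomparable : forall C1 C2,
    C1 \in circuits -> C2 \in circuits -> C1 \subset C2 -> C1 = C2;
  circuit_elimination : forall C1 C2 e,
    C1 \in circuits -> C2 \in circuits -> C1 != C2 -> e \in C1 :&: C2 ->
    exists2 C3, C3 \in circuits & C3 \subset (C1 :|: C2) :\ e
}.

Section MatroidNotions.
Variables (E : finType) (M : matroid E).

Definition indep (X : {set E}) := [forall C in circuits M, ~~ (C \subset X)].

Definition rank := \max_(X : {set E} | indep X) #|X|.

Definition simple_matroid :=
  forall C, C \in circuits M -> #|C| <> 1 /\ #|C| <> 2.

End MatroidNotions.

Definition isomorphic (E F : finType) (M : matroid E) (N : matroid F) :=
  exists2 f : E -> F, bijective f &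
    forall C : {set E}, (C \in circuits M) = (f @: C \in circuits N).

Section ColumnMatroid.
Variables (F : fieldType) (k m : nat) (A : 'M[F]_(k, m)).
Local Open Scope ring_scope.

(* Dependence of the family of columns indexed by S: equal columns with
   distinct indices are dependent. *)
Definition dependent_cols (S : {set 'I_m}) :=
  ~~ free [seq col i A | i in S].

Definition column_circuits := [set S | minset dependent_cols S].

Definition col_relation (a : 'I_m -> F) (S : {set 'I_m}) :=
  \sum_i a i *: col i A = 0 /\ forall i, i \notin S -> a i = 0.

Lemma col_relationE a (S : {set 'I_m}) : (forall i, i \notin S -> a i = 0) ->
  \sum_i a i *: col i A = \sum_(i < #|S|) a (enum_val i) *: col (enum_val i) A.
Proof.
move=> aS; rewrite -(big_enum_val (fun i => a i *: col i A)).
rewrite [LHS](bigID (mem S)) /= [X in _ + X]big1 ?addr0 // => i /aS ->.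
by rewrite scale0r.
Qed.

Lemma dependent_cols_intro a S i :
  col_relation a S -> a i != 0 -> dependent_cols S.
Proof.
move=> [a0 aS] ai; apply/negP => frS.
have iS : i \in S by apply: contraNT ai => /aS ->.
have /freeP /(_ (fun j => a (enum_val j))) := frS : free [tuple of [seq col i A | i in S]].
move=> H; have : a (enum_val (enum_rank_in iS i)) = 0.
  apply: H; rewrite -[RHS]a0 (col_relationE aS) //.
  by apply: eq_bigr => j _; rewrite nth_image.
by rewrite enum_rankK_in // => /eqP; rewrite (negPf ai).
Qed.

Lemma dependent_cols_elim S : dependent_cols S ->
  (forall a i, col_relation a S -> a i != 0 -> False) -> False.
Proof.
move=> /negP depS H; apply: depS.
apply/(@freeP _ _ _ [tuple of [seq col i A | i in S]]) => b b0 j.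
apply/eqP/negPn/negP => bj.
have jS : enum_val j \in S by exact: enum_valP.
pose a i := if i \in S then b (enum_rank_in jS i) else 0.
have aE i : a (enum_val i) = b i.
  by rewrite /a enum_valP enum_valK_in.
apply: (H a (enum_val j)); last by rewrite aE.
have aS i : i \notin S -> a i = 0 by rewrite /a => /negPf ->.
split=> //; rewrite (col_relationE aS) // -[RHS]b0.
by apply: eq_bigr => i _; rewrite aE nth_image.
Qed.

Lemma col_relation_support a C i : C \in column_circuits ->
  col_relation a C -> a i != 0 -> forall j, j \in C -> a j != 0.
Proof.
rewrite inE => Cmin [a0 aC] ai j jC.
have sC : [set x | a x != 0] \subset C.
  by apply/subsetP => x; rewrite inE; apply: contraNT => /aC ->.
suff CE : [set x | a x != 0] = C by rewrite -CE inE in jC.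
apply: minsetinf Cmin _ sC; apply: (dependent_cols_intro (a := a)) ai.
by split=> // x; rewrite inE negbK => /eqP.
Qed.

Lemma column_circuit_neq0 C : C \in column_circuits -> C != set0.
Proof.
rewrite inE => /minsetp; apply: contraL => /eqP ->.
by rewrite /dependent_cols negbK /image_mem enum_set0 nil_free.
Qed.

Lemma column_circuit_incomparable C1 C2 :
  C1 \in column_circuits -> C2 \in column_circuits -> C1 \subset C2 -> C1 = C2.
Proof. by rewrite !inE => /minsetp dC1 C2min sC; apply: minsetinf C2min dC1 sC. Qed.

Lemma column_circuit_elimination C1 C2 e :
  C1 \in column_circuits -> C2 \in column_circuits -> C1 != C2 ->
  e \in C1 :&: C2 ->
  exists2 C3, C3 \in column_circuits & C3 \subset (C1 :|: C2) :\ e.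
Proof.
move=> cC1 cC2 neC /setIP[eC1 eC2].
have /minset_exists[C3 C3min sC3] : dependent_cols ((C1 :|: C2) :\ e); last first.
  by exists C3 => //; rewrite inE.
have /subsetPn[f fC1 fC2] : ~~ (C1 \subset C2).
  by apply: contraNN neC => sC; apply/eqP; apply: column_circuit_incomparable.
have /minsetp d1 : minset dependent_cols C1 by rewrite inE in cC1.
have /minsetp d2 : minset dependent_cols C2 by rewrite inE in cC2.
apply/negP => frU.
apply: (dependent_cols_elim d1) => a i ra ai.
apply: (dependent_cols_elim d2) => b j rb bj.
have a_neq0 := col_relation_support cC1 ra ai.
have b_neq0 := col_relation_support cC2 rb bj.
case: ra rb => [a0 aC1] [b0 bC2].
suff: dependent_cols ((C1 :|: C2) :\ e) by rewrite /dependent_cols frU.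
apply: (@dependent_cols_intro (fun x => b e * a x - a e * b x) _ f); last first.
  by rewrite (bC2 f fC2) mulr0 subr0 mulf_neq0 ?a_neq0 ?b_neq0.
split=> [|x].
  transitivity (b e *: (\sum_i a i *: col i A) - a e *: (\sum_i b i *: col i A)).
    rewrite !scaler_sumr -sumrB; apply: eq_bigr => x _.
    by rewrite scalerBl !scalerA.
  by rewrite a0 b0 !scaler0 subr0.
rewrite !inE negb_and negbK negb_or => /orP[/eqP -> | /andP[x1 x2]].
  by rewrite mulrC subrr.
by rewrite (aC1 x x1) (bC2 x x2) !mulr0 subr0.
Qed.

Definition column_matroid : matroid 'I_m :=
  Matroid column_circuit_neq0 column_circuit_incomparable
    column_circuit_elimination.

End ColumnMatroid.

Definition binary (E : finType) (M : matroid E) :=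
  exists k m (A : 'M['F_2]_(k, m)), isomorphic M (column_matroid A).

Section Colourings.
Variables (E : finType) (K : eqType) (c : E -> K).

Definition colour_class (x : K) : {set E} := [set e | c e == x].

Definition rainbow (X : {set E}) := {in X &, injective c}.

End Colourings.

(* Main.v *)
(** Let [u_0, ..., u_{n-1}] be the standard basis of [F_2^n], and let [f] be
    the self-map of the indices consisting of one directed cycle of length
    [n - 2] and two further points [y], [z] sent to the same point of the cycle.
    In the quotient of [F_2^n] by the all-ones vector, take the [2n] vectors
    [u_i] and [u_i + u_{f i}], giving both of them colour [i].

    A rainbow dependency uses [u_i] for [i] in [a] and [u_i + u_{f i}] for [i] in
    [b], with [a] and [b] disjoint, and its sum in [F_2^n] is zero or all-ones.
    If it is zero then [b] is contained in [f(b)], which forces [b] to be the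
    whole cycle.  If it is all-ones then every index outside [a] and [b] is in
    [f(b)], so at most half of the indices are outside; if exactly half are, then
    [f] is injective on [b] and [a] is contained in [b], and [b] contains [y] and
    [z] because these are not values of [f], contradicting [f y = f z]. *)
Require Import Defs.
From mathcomp Require Import all_boot all_order all_algebra.
From mathcomp Require Import zify.

Set Implicit Arguments.
Unset Strict Implicit.
Unset Printing Implicit Defensive.

Import GRing.Theory.

Lemma F2_neq0 (x : 'F_2) : x != 0%R -> x = 1%R.
Proof. by case: x => [[|[|//]] Hx] // _; apply: val_inj. Qed.

Lemma split_lshift m n (i : 'I_m) : split (lshift n i) = inl i.
Proof. exact: (unsplitK (inl i)). Qed.

Lemma split_rshift m n (i : 'I_n) : split (rshift m i) = inr i.
Proof. exact: (unsplitK (inr i)). Qed.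

(** * Independence and rank in column matroids *)

Section ColumnMatroidRank.
Variables (F : fieldType) (k m : nat) (A : 'M[F]_(k, m)).

Lemma indep_column_matroid (X : {set 'I_m}) :
  indep (column_matroid A) X = ~~ dependent_cols A X.
Proof.
apply/forall_inP/negP => [indX /minset_exists[C Cmin sCX] | frX C].
  by have := indX C; rewrite /= inE Cmin sCX => /(_ isT).
rewrite /= inE => /minsetp dC; apply/negP => sCX; apply: frX.
apply/negP => frX; apply: (dependent_cols_elim dC) => a i [a0 aC] ai.
suff: dependent_cols A X by rewrite /dependent_cols frX.
apply: dependent_cols_intro (ai); split=> // j jX.
by apply: aC; apply: contraNN jX => /(subsetP sCX).
Qed.

Lemma rank_column_matroid_le : rank (column_matroid A) <= k.
Proof.
apply/bigmax_leqP => X; rewrite indep_column_matroid negbK => frX.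
have := dimvS (subvf <<[seq col i A | i in X]>>%VS).
by rewrite (eqP frX) dimvf /dim /= muln1 size_image.
Qed.

End ColumnMatroidRank.

(** * The matroid of a self-map [f]: relations, rainbow sets and rank *)

Section FunctionalMatroid.
Variables (k : nat) (f : 'I_k.+1 -> 'I_k.+1).
Local Open Scope ring_scope.

Definition fun_vec (e : 'I_(k.+1 + k.+1)) (j : 'I_k.+1) : 'F_2 :=
  match split e with
  | inl i => (i == j)%:R
  | inr i => (i == j)%:R + (f i == j)%:R
  end.

(* Subtracting the coordinate [0] from the others realizes the quotient by the
   all-ones vector as [F_2^k]. *)
Definition fun_mx : 'M['F_2]_(k, k.+1 + k.+1) :=
  \matrix_(j, e) (fun_vec e (lift ord0 j) - fun_vec e ord0).

Definition fun_colour (e : 'I_(k.+1 + k.+1)) : 'I_k.+1 :=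
  match split e with inl i => i | inr i => i end.

Lemma fun_colourl i : fun_colour (lshift k.+1 i) = i.
Proof. by rewrite /fun_colour split_lshift. Qed.

Lemma fun_colourr i : fun_colour (rshift k.+1 i) = i.
Proof. by rewrite /fun_colour split_rshift. Qed.

Lemma fun_colour_class (e : 'I_(k.+1 + k.+1)) :
  #|colour_class (fun x => fun_colour x : nat) (fun_colour e)| = 2.
Proof.
set i := fun_colour e.
rewrite (_ : colour_class _ _ = [set lshift k.+1 i; rshift k.+1 i]).
  by rewrite cards2 eq_lrshift.
apply/setP => x; rewrite !inE (inj_eq val_inj).
case: (split_ordP x) => j ->.
  by rewrite fun_colourl (inj_eq (@lshift_inj _ _)) eq_lrshift orbF.
by rewrite fun_colourr (inj_eq (@rshift_inj _ _)) eq_rlshift.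
Qed.

(** Coordinate [j] of the lifted combination, before passing to the quotient, sorted by which
    vectors reach [j]: [u_j], [u_j + u_{f j}], and those with [f i = j]. *)
Definition fun_comb (s : 'I_(k.+1 + k.+1) -> 'F_2) (j : 'I_k.+1) : 'F_2 :=
  s (lshift _ j) + s (rshift _ j) + \sum_(i | f i == j) s (rshift _ i).

Lemma fun_combE s j : fun_comb s j = \sum_e s e * fun_vec e j.
Proof.
have sum_delta (h : 'I_k.+1 -> 'F_2) : \sum_i h i * (i == j)%:R = h j.
  rewrite (bigD1 j) //= eqxx mulr1 big1 ?addr0 // => i /negPf ->.
  by rewrite mulr0.
rewrite big_split_ord /= /fun_comb -addrA; congr (_ + _).
  rewrite -(sum_delta (fun i => s (lshift _ i))); apply: eq_bigr => i _.
  by rewrite /fun_vec split_lshift.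
rewrite -(sum_delta (fun i => s (rshift _ i))) [X in _ + X]big_mkcond -big_split /=.
apply: eq_bigr => i _; rewrite /fun_vec split_rshift mulrDr; congr (_ + _).
by case: (f i == j); rewrite ?mulr1 ?mulr0.
Qed.

(** A relation in the quotient lifts to a multiple of the all-ones vector. *)
Lemma fun_comb_const s : \sum_e s e *: col e fun_mx = 0 ->
  forall j, fun_comb s j = fun_comb s ord0.
Proof.
move=> s0 j; case: (unliftP ord0 j) => [j' ->|-> //].
apply/eqP; rewrite -subr_eq0 !fun_combE -sumrB.
move/matrixP: s0 => /(_ j' ord0); rewrite summxE mxE => s0.
rewrite -[X in _ == X]s0; apply/eqP/eq_bigr => e _.
by rewrite !mxE mulrBr.
Qed.

Definition supp_l (s : 'I_(k.+1 + k.+1) -> 'F_2) :=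
  [set i | s (lshift _ i) != 0].

Definition supp_r (s : 'I_(k.+1 + k.+1) -> 'F_2) :=
  [set i | s (rshift _ i) != 0].

Lemma fun_comb_notin_imset s j : j \notin f @: supp_r s ->
  fun_comb s j = s (lshift _ j) + s (rshift _ j).
Proof.
move=> jNf; rewrite /fun_comb big1 ?addr0 // => i /eqP fij.
apply/eqP; apply: contraNT jNf => si; rewrite -fij; apply: imset_f.
by rewrite inE.
Qed.

Lemma supp_subset_colours s (C : {set 'I_(k.+1 + k.+1)}) :
  (forall e, e \notin C -> s e = 0) ->
  supp_l s :|: supp_r s \subset fun_colour @: C.
Proof.
move=> sC; apply/subsetP => i; rewrite !inE => /orP[] si.
  rewrite -(fun_colourl i); apply: imset_f.
  by apply: contraNT si => /sC ->.
rewrite -(fun_colourr i); apply: imset_f.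
by apply: contraNT si => /sC ->.
Qed.

Lemma supp_disjoint s (C : {set 'I_(k.+1 + k.+1)}) :
  (forall e, e \notin C -> s e = 0) -> {in C &, injective fun_colour} ->
  forall i, i \in supp_r s -> s (lshift _ i) = 0.
Proof.
move=> sC injC i; rewrite inE => sri; apply/eqP/negPn/negP => sli.
have lC : lshift k.+1 i \in C by apply: contraNT sli => /sC ->.
have rC : rshift k.+1 i \in C by apply: contraNT sri => /sC ->.
have := injC _ _ lC rC; rewrite fun_colourl fun_colourr => /(_ erefl) /eqP.
by rewrite eq_lrshift.
Qed.

Lemma rainbow_relation_card (C : {set 'I_(k.+1 + k.+1)}) s e y z :
  (forall b : {set 'I_k.+1}, b != set0 -> b \subset f @: b ->
     k.+1./2 < #|b|)%N ->
  y != z -> f y = f z -> (forall i, f i != y) -> (forall i, f i != z) ->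
  col_relation fun_mx s C -> s e != 0 -> {in C &, injective fun_colour} ->
  (k.+1./2 < #|C|)%N.
Proof.
move=> f_cyc yz fyz fNy fNz [s0 sC] se injC.
have sub_ab := supp_subset_colours sC.
have disj := supp_disjoint sC injC.
have cst := fun_comb_const s0.
set a := supp_l s in sub_ab *; set b := supp_r s in sub_ab disj *.
have cardC : (#|a :|: b| <= #|C|)%N.
  by rewrite -(card_in_imset injC) subset_leq_card.
have cardb : (#|b| <= #|a :|: b|)%N by rewrite subset_leq_card ?subsetUr.
have [x0|/F2_neq0 x1] := eqVneq (fun_comb s ord0) 0.
  have [b0|bN0] := eqVneq b set0.
    have srE i : s (rshift _ i) = 0.
      by apply/eqP; have := in_set0 i; rewrite -b0 inE => /negbT; rewrite negbK.
    have slE i : s (lshift _ i) = 0.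
      have := cst i; rewrite x0 fun_comb_notin_imset ?srE ?addr0 //.
      by rewrite -/b b0 imset0 inE.
    by case/eqP: se; case: (split_ordP e) => i ->.
  (* If [i] in [b] were missed by [f @: b], coordinate [i] would reduce to [s (rshift _ i)], which
     is nonzero. *)
  apply: (leq_trans (f_cyc b bN0 _) (leq_trans cardb cardC)).
  apply/subsetP => i ib; apply: contraLR ib => iNf.
  have := cst i; rewrite x0 fun_comb_notin_imset // => sE.
  apply/negP => ib; move: (sE); rewrite disj // add0r => sri.
  by move: ib; rewrite inE sri eqxx.
have sub_out : ~: (a :|: b) \subset f @: b.
  apply/subsetP => i; rewrite !inE negb_or !negbK => /andP[/eqP sl /eqP sr].
  apply/negPn/negP => iNf; have := cst i.
  by rewrite x1 fun_comb_notin_imset // sl sr addr0 => /eqP; rewrite eq_sym oner_eq0.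
have card_out := subset_leq_card sub_out.
have card_f := leq_imset_card f b.
have := cardsC (a :|: b); rewrite card_ord => cardT.
(* With [n = k.+1], the chain [n - #|a :|: b| <= #|f @: b| <= #|b| <= #|a :|: b| <= n./2] forces
   equality throughout. *)
rewrite ltnNge; apply/negP => leC.
have bE : b = a :|: b.
  by apply/eqP; rewrite eqEcard subsetUr andTb; lia.
have /imset_injP inj_b : #|f @: b| == #|b| by lia.
have notf_in_b w : (forall i, f i != w) -> w \in b.
  move=> fNw; rewrite bE -[_ \in _]negbK -in_setC.
  apply/negP => /(subsetP sub_out)/imsetP[i _ wE].
  by have := fNw i; rewrite -wE eqxx.
by case/eqP: yz; apply: inj_b => //; apply: notf_in_b.
Qed.

(** Used for simplicity: the two columns of one colour are independent. *)
Lemma monochromatic_relation (C : {set 'I_(k.+1 + k.+1)}) s i :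
  (1 < k)%N -> f i != i -> C \subset [set lshift _ i; rshift _ i] ->
  col_relation fun_mx s C -> forall e, s e = 0.
Proof.
move=> k_gt1 fii sCi [s0 sC].
have cst := fun_comb_const s0.
have sl j : j != i -> s (lshift _ j) = 0.
  move=> ji; apply: sC; apply: contraNN ji => /(subsetP sCi).
  by rewrite !inE (inj_eq (@lshift_inj _ _)) eq_lrshift orbF.
have sr j : j != i -> s (rshift _ j) = 0.
  move=> ji; apply: sC; apply: contraNN ji => /(subsetP sCi).
  by rewrite !inE (inj_eq (@rshift_inj _ _)) eq_rlshift.
have sumE j : \sum_(h | f h == j) s (rshift _ h) =
    if f i == j then s (rshift _ i) else 0.
  rewrite big_mkcond (bigD1 i) //= big1 ?addr0 // => h hi.
  by rewrite sr //; case: ifP.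
(* As there are at least three indices, some [j] is untouched by both vectors, so the lifted sum is
   zero; coordinates [f i] and then [i] kill the two coefficients. *)
have /card_gt0P[j] : (0 < #|~: [set i; f i]|)%N.
  have := cardsC [set i; f i]; rewrite card_ord cards2; case: eqP => _; lia.
rewrite !inE negb_or => /andP[ji jfi].
have x0 h : fun_comb s h = 0.
  rewrite cst -(cst j) /fun_comb sl // sr // sumE eq_sym (negPf jfi).
  by rewrite !addr0.
have sri : s (rshift _ i) = 0.
  by have := x0 (f i); rewrite /fun_comb sl // sr // sumE eqxx !add0r.
have sli : s (lshift _ i) = 0.
  by have := x0 i; rewrite /fun_comb sri sumE (negPf fii) !addr0.
move=> e; case: (split_ordP e) => h ->.
  by have [->|/sl] := eqVneq h i.
by have [->|/sr] := eqVneq h i.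
Qed.

(** The images of the [u_i] with [i != 0] are independent: a combination of them has lifted
    coordinate 0 equal to zero, hence all coordinates zero. *)
Lemma rank_fun_mx : rank (column_matroid fun_mx) = k.
Proof.
apply/eqP; rewrite eqn_leq rank_column_matroid_le /=.
pose X := [set lshift k.+1 i | i in [set~ (ord0 : 'I_k.+1)]].
have cardX : #|X| = k.
  by rewrite card_imset ?cardsC1 ?card_ord //; apply: lshift_inj.
rewrite -{1}cardX; apply: (leq_bigmax_cond X).
rewrite indep_column_matroid; apply/negP => dX.
apply: (dependent_cols_elim dX) => s e [s0 sX]; case/negP; apply/eqP.
have sr i : s (rshift _ i) = 0.
  by apply: sX; apply/imsetP => -[j _ /eqP]; rewrite eq_rlshift.
have s00 : s (lshift _ ord0) = 0.
  apply: sX; apply/imsetP => -[j]; rewrite !inE => j0 /lshift_inj j0E.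
  by rewrite -j0E eqxx in j0.
have xE j : fun_comb s j = s (lshift _ j).
  by rewrite /fun_comb sr big1 ?addr0.
case: (split_ordP e) => i -> //.
by rewrite -xE (fun_comb_const s0) xE.
Qed.

End FunctionalMatroid.

(** * The cycle on [0, ..., p] with tails [p + 1] and [p + 2] attached at [0] *)

Section TwoTailedCycle.
Variable p : nat.

Definition cycle_tails (i : 'I_p.+3) : 'I_p.+3 :=
  if i < p then inord i.+1 else ord0.

Lemma cycle_tailsE i : cycle_tails i = (if i < p then i.+1 else 0) :> nat.
Proof. by rewrite /cycle_tails; case: ifP => // ip; rewrite inordK //; lia. Qed.

(** Taking preimages inside [b] descends to [0]; a preimage of [0] is at least [p], and descending
    from it fills [0, ..., p]. *)
Lemma cycle_tails_closed (b : {set 'I_p.+3}) :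
  b != set0 -> b \subset cycle_tails @: b -> p.+1 <= #|b|.
Proof.
move=> /set0Pn[i0 ib] sub_b.
have pre (j : nat) : inord j.+1 \in b -> j.+1 < p.+3 -> (inord j \in b) && (j < p).
  move=> jb jp; have /imsetP[i iB /(congr1 val)] := subsetP sub_b _ jb.
  rewrite /= inordK // cycle_tailsE; case: ifP => // ip [jE].
  by rewrite jE inord_val iB.
have down d j : j + d < p.+3 -> inord (j + d) \in b -> inord j \in b.
  elim: d => [|d IHd]; first by rewrite addn0.
  rewrite addnS => lt_jd /pre /(_ lt_jd) /andP[jdb _].
  by apply: IHd => //; lia.
have b0 : inord 0 \in b by apply: (down i0 0); rewrite add0n ?inord_val.
have bp : inord p \in b.
  have /imsetP[i iB /(congr1 val)] := subsetP sub_b _ b0.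
  rewrite /= inordK // cycle_tailsE; case: ifP => // /negbT; rewrite -leqNgt => pi _.
  by apply: (down (i - p) p); rewrite subnKC ?inord_val.
pose g (j : 'I_p.+1) : 'I_p.+3 := inord j.
have gE j : g j = j :> nat by rewrite inordK //; have := ltn_ord j; lia.
have g_inj : injective g.
  by move=> j1 j2 /(congr1 val) /=; rewrite !gE => /val_inj.
have cardg : #|g @: 'I_p.+1| = p.+1 by rewrite card_imset ?card_ord.
apply: leq_trans (_ : #|g @: 'I_p.+1| <= _); first by rewrite cardg.
apply: subset_leq_card.
apply/subsetP => _ /imsetP[j _ ->]; apply: (down (p - j) j); have := ltn_ord j.
  lia.
by move=> jp; rewrite subnKC.
Qed.

Lemma cycle_tails_neq i : 0 < p -> cycle_tails i != i.
Proof.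
move=> p0; apply/eqP => /(congr1 val); rewrite /= cycle_tailsE.
by case: ltnP; lia.
Qed.

Lemma cycle_tails_le i : cycle_tails i <= p.
Proof. by rewrite cycle_tailsE; case: ltnP; lia. Qed.

End TwoTailedCycle.

Theorem theorem4p3 (n : nat) (n_even : ~~ odd n) (n_ge6 : 6 <= n) :
  exists (E : finType) (M : matroid E) (c : E -> nat),
    [/\ simple_matroid M, binary M, rank M = n - 1 & #|E| = 2 * n] /\
    (forall e : E, #|colour_class c (c e)| = 2) /\
    (forall C : {set E}, C \in circuits M -> rainbow c C -> n./2 < #|C|).
Proof.
case: n n_even n_ge6 => [|[|[|p]]] // _ p_ge3.
pose A := fun_mx (@cycle_tails p).
pose c (e : 'I_(p.+3 + p.+3)) : nat := fun_colour e.
have rainbow_card (C : {set 'I_(p.+3 + p.+3)}) :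
    C \in circuits (column_matroid A) -> rainbow c C -> p.+3./2 < #|C|.
  rewrite /= inE => /minsetp dC rC; rewrite ltnNge; apply/negP => leC.
  apply: (dependent_cols_elim dC) => s e rel se; move: leC.
  apply/negP; rewrite -ltnNge.
  (* The tails [p + 1] and [p + 2] serve as [y] and [z]: both map to [0], and all values of the map
     are at most [p]. *)
  apply: (@rainbow_relation_card _ _ C s e (inord p.+1) (inord p.+2) _ _ _ _ _ rel se).
  - move=> b b0 /(cycle_tails_closed b0); lia.
  - by apply/eqP => /(congr1 val); rewrite /= !inordK //; lia.
  - by apply: val_inj; rewrite /= !cycle_tailsE !inordK //; do 2 case: ltnP; lia.
  - move=> i; apply/eqP => /(congr1 val); rewrite /= inordK // => E.
    by have := cycle_tails_le i; rewrite E; lia.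
  - move=> i; apply/eqP => /(congr1 val); rewrite /= inordK // => E.
    by have := cycle_tails_le i; rewrite E; lia.
  - by move=> x y xC yC xy; apply: rC => //; rewrite /c xy.
exists 'I_(p.+3 + p.+3), (column_matroid A), c.
split; last by split=> // e; apply: fun_colour_class.
split; first last.
- by rewrite card_ord mul2n addnn.
- by rewrite rank_fun_mx subn1.
- by exists p.+2, (p.+3 + p.+3), A, id => [|C]; [exists id | rewrite imset_id].
(* A rainbow circuit has more than [n./2 >= 3] elements; a non-rainbow one of size at most 2 would
   be a pair of one colour, which is independent. *)
suff gt2 (C : {set 'I_(p.+3 + p.+3)}) : C \in column_circuits A -> 2 < #|C|.
  by move=> C /gt2; lia.
move=> cC; rewrite ltnNge; apply/negP => leC.
have [/dinjectiveP injC | /dinjectivePn[x xC [y /andP[yx yC] cxy]]] :=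
  boolP (dinjectiveb c (mem C)).
  by have := rainbow_card C cC injC; lia.
have CE : [set x; y] = C.
  apply/eqP; rewrite eqEcard cards2 eq_sym yx leC andbT.
  by apply/subsetP => e; rewrite !inE => /orP[] /eqP ->.
have := cC; rewrite inE => /minsetp dC.
apply: (dependent_cols_elim dC) => s e rel; case/negP; apply/eqP.
apply: (monochromatic_relation (i := fun_colour x) _ _ _ rel) => //.
  by apply: cycle_tails_neq; lia.
rewrite -CE; apply/subsetP => z /set2P zxy.
have cz : fun_colour z = fun_colour x.
  by case: zxy => -> //; apply: val_inj.
rewrite -cz !inE; case: (split_ordP z) => i ->.
  by rewrite fun_colourl eqxx.
by rewrite fun_colourr eqxx orbT.
Qed.
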